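(* Let $(U,Y(\cdot,z),\mathbf 1,\omega)$ and $(V,Y(\cdot,z),\mathbf 1,\omega)$ be vertex operator superalgebras such that: (1) $(V,Y(\cdot,z),\mathbf 1,\omega)$ is a simple vertex operator algebra; (2) $V$ is a subalgebra of $U$ having the same Virasoro element $\omega$; (3) there exists an irreducible $\omega$-ordinary $V$-module $V^1$ such that $U$, viewed as an $\omega$-ordinary $V$-module, has the decomposition $U=V\oplus V^1$, and moreover $V^1\cdot V^1$, the span of $\{u_{(n)}w\mid u,w\in V^1,\ n\in\mathbb Z\}$, viewed as an $\omega$-ordinary $V$-module, is isomorphic to $V$. Let $\mathcal C$ be a subcategory of the category of weak $V$-modules such that $\mathcal C$ is semisimple and, for any weak $V$-module $M$ in $\mathcal C$, all the $V$-submodules of $M$ are also in $\mathcal C$. Let $\mathcal D$ be the subcategory of the category of weak $U$-modules such that $M\in\mathcal D$ if and only if $M$, viewed as a weak $V$-module, belongs to $\mathcal C$. Then the category $\mathcal D$ is semisimple.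
   Context: A vertex operator superalgebra is a vertex superalgebra $V$ over $\mathbb C$ (with translation operator $D$) with an even vector $\omega$ (Virasoro element) such that the operators $L(n)=\omega_{(n+1)}$ satisfy the Virasoro relations for some central charge, $L(-1)=D$, and $V=\bigoplus_{n\in\mathbb Q}V_n$ with $L(0)|_{V_n}=n$, $\dim V_n<\infty$ and $V_n=0$ for $n$ sufficiently small (conformal weights are allowed to be rational). It is a vertex operator algebra if it is purely even. A weak $V$-module is a vector superspace $M$ with a parity preserving linear map $v\mapsto Y_M(v,z)=\sum_{n\in\mathbb Z}v_{(n)}z^{-n-1}$, $v_{(n)}\in\mathrm{End}\,M$, such that $v_{(n)}w=0$ for $n$ sufficiently large (for each $v\in V$, $w\in M$), $Y_M(\mathbf 1,z)=\mathrm{id}_M$ and the (super) Jacobi identity holds; no grading is required. It is $\omega$-ordinary if $M=\bigoplus_{\lambda\in\mathbb C}M_\lambda$ with $M_\lambda=\{w\in M\mid L(0)w=\lambda w\}$ finite dimensional and $M_\lambda=0$ if the real part of $\lambda$ is sufficiently small. A category of weak modules is semisimple if each of its objects is a direct sum of irreducible weak modules.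
   Formalization: Hypothesis (3) additionally requires that V^1·V^1 be contained in the summand V of U; with only an abstract isomorphism V^1·V^1 ≅ V the claim fails, e.g. V=C, U=C[e]/(e^2), V^1=C(1+e), C = all superspaces. *)

(* Defs.v *)
(* The field of complex numbers is [R[i]], for an arbitrary model
   [R : realType] of the real numbers. *)
From HB Require Import structures.
From mathcomp Require Import all_boot all_order all_algebra.
From mathcomp Require Import boolp classical_sets reals.
From mathcomp Require Import complex.

Set Implicit Arguments.
Unset Strict Implicit.
Unset Printing Implicit Defensive.

Import Order.TTheory GRing.Theory Num.Theory.

Local Open Scope classical_set_scope.
Local Open Scope ring_scope.

Definition is_subspace (K : fieldType) (W : lmodType K) (S : set W) : Prop :=
  S 0 /\ forall (a : K) (x y : W), S x -> S y -> S (a *: x + y).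

Definition lin_span (K : fieldType) (W : lmodType K) (A : set W) : set W :=
  [set x | exists (n : nat) (c : 'I_n -> K) (e : 'I_n -> W),
     (forall i, A (e i)) /\ x = \sum_(i < n) c i *: e i].

Definition fin_dim (K : fieldType) (W : lmodType K) (S : set W) : Prop :=
  exists (n : nat) (e : 'I_n -> W), S = lin_span (range e).

Definition is_direct_sum (K : fieldType) (W : lmodType K) (I : choiceType)
    (S : I -> set W) : Prop :=
  [/\ forall i, is_subspace (S i),
      forall w : W, exists (s : seq I) (f : I -> W),
        (forall i, S i (f i)) /\ w = \sum_(i <- s) f i
    & forall (s : seq I) (f : I -> W), uniq s -> (forall i, S i (f i)) ->
        \sum_(i <- s) f i = 0 -> forall i, i \in s -> f i = 0].

(* [par false] is the even part and [par true] is the odd part. *)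
Record superspace (R : realType) := Superspace {
  ss_sort :> lmodType R[i];
  par : bool -> set ss_sort;
  par_direct : is_direct_sum par
}.
Arguments par {R s}.

(* The generalized binomial coefficient m (m-1) ... (m-k+1) / k!. *)
Definition binomz (K : fieldType) (m : int) (k : nat) : K :=
  (\prod_(j < k) (m%:~R - j%:R)) / (k`!)%:R.

(* The Jacobi identity for Y (on V) and YM (on M), in components: comparing
   the coefficients of z0^(-l-1) z1^(-m-1) z2^(-n-1) gives
     \sum_(i >= 0) C(m, i) (u_(l+i) v)_(m+n-i)
       = \sum_(i >= 0) (-1)^i C(l, i)
           (u_(l+m-i) v_(n+i) - (-1)^(l + |u||v|) v_(l+n-i) u_(m+i)).
   Applied to w, both sums have finitely many nonzero terms by the truncation
   conditions, so they equal their partial sums of large length N. *)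
Definition jacobi_identity (R : realType) (V M : superspace R)
    (Y : V -> int -> V -> V) (YM : V -> int -> M -> M) : Prop :=
  forall (p q : bool) (u v : V) (w : M) (l m n : int), par p u -> par q v ->
  exists N0 : nat, forall N : nat, (N0 <= N)%N ->
    \sum_(i < N) binomz R[i] m i *: YM (Y u (l + i%:Z) v) (m + n - i%:Z) w =
    \sum_(i < N) ((-1) ^+ i * binomz R[i] l i) *:
      (YM u (l + m - i%:Z) (YM v (n + i%:Z) w)
       - ((-1) ^ l * (-1) ^+ (p && q)) *:
           YM v (l + n - i%:Z) (YM u (m + i%:Z) w)).

(* [mode u n w] is u_(n) w. *)
Record vertex_superalgebra (R : realType) := VertexSuperalgebra {
  vs_space :> superspace R;
  mode : vs_space -> int -> vs_space -> vs_space;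
  vac : vs_space;
  transl : vs_space -> vs_space;
  mode_linl : forall n w, linear (fun u => mode u n w);
  mode_linr : forall u n, linear (mode u n);
  mode_par : forall p q u n w,
    par p u -> par q w -> par (p (+) q) (mode u n w);
  mode_trunc : forall u w, exists N : int, forall n, N <= n -> mode u n w = 0;
  vac_even : par false vac;
  mode_vac : forall n w, mode vac n w = if n == -1 then w else 0;
  mode_creation : forall u, mode u (-1) vac = u;
  mode_creation0 : forall u n, 0 <= n -> mode u n vac = 0;
  transl_linear : linear transl;
  transl_derivative : forall u n w,
    mode (transl u) n w = - n%:~R *: mode u (n - 1) w;
  transl_commutator : forall u n w,
    transl (mode u n w) - mode u n (transl w) = - n%:~R *: mode u (n - 1) w;
  mode_jacobi : jacobi_identity mode mode
}.
Arguments mode {R v}.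
Arguments vac {R v}.
Arguments transl {R v}.

Record weak_module (R : realType) (V : vertex_superalgebra R) := WeakModule {
  wm_space :> superspace R;
  act : V -> int -> wm_space -> wm_space;
  act_linl : forall n w, linear (fun v => act v n w);
  act_linr : forall v n, linear (act v n);
  act_par : forall p q v n w,
    par p v -> par q w -> par (p (+) q) (act v n w);
  act_trunc : forall v w, exists N : int, forall n, N <= n -> act v n w = 0;
  act_vac : forall n w, act vac n w = if n == -1 then w else 0;
  act_jacobi : jacobi_identity mode act
}.
Arguments act {R V w0}.

Definition adjoint_module (R : realType) (V : vertex_superalgebra R) : weak_module V :=
  WeakModule (@mode_linl R V) (@mode_linr R V) (@mode_par R V)
    (@mode_trunc R V) (@mode_vac R V) (@mode_jacobi R V).

(* Submodules are sub-superspaces, so that they are weak modules themselves. *)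
Record submodule (R : realType) (V : vertex_superalgebra R)
    (M : weak_module V) := Submodule {
  sub_set :> set M;
  sub_subspace : is_subspace sub_set;
  sub_graded : forall w, sub_set w -> exists w0 w1 : M,
    [/\ sub_set w0, par false w0, sub_set w1, par true w1 & w = w0 + w1];
  sub_stable : forall v n w, sub_set w -> sub_set (act v n w)
}.

Definition sub_pred (R : realType) (V : vertex_superalgebra R)
    (M : weak_module V) (N : submodule M) : {pred M} :=
  fun x => x \in sub_set N.

Lemma sub_predP (R : realType) (V : vertex_superalgebra R)
    (M : weak_module V) (N : submodule M) (x : M) :
  reflect (sub_set N x) (x \in sub_pred N).
Proof. by apply: (iffP idP); rewrite /sub_pred unfold_in in_setE. Qed.

Lemma sub_submod_closed (R : realType) (V : vertex_superalgebra R)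
    (M : weak_module V) (N : submodule M) : submod_closed (sub_pred N).
Proof.
have [N0 NL] := sub_subspace N; split; first exact/sub_predP.
by move=> a x y /sub_predP Nx /sub_predP Ny; apply/sub_predP/NL.
Qed.

HB.instance Definition _ (R : realType) (V : vertex_superalgebra R)
    (M : weak_module V) (N : submodule M) :=
  GRing.isSubmodClosed.Build R[i] M (sub_pred N) (sub_submod_closed N).

Record sub_sort (R : realType) (V : vertex_superalgebra R)
    (M : weak_module V) (N : submodule M) :=
  SubSort { sub_val : M; sub_valP : sub_val \in sub_pred N }.

HB.instance Definition _ (R : realType) (V : vertex_superalgebra R)
    (M : weak_module V) (N : submodule M) := [isSub for @sub_val R V M N].
HB.instance Definition _ (R : realType) (V : vertex_superalgebra R)
    (M : weak_module V) (N : submodule M) := [Choice of sub_sort N by <:].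
HB.instance Definition _ (R : realType) (V : vertex_superalgebra R)
    (M : weak_module V) (N : submodule M) :=
  [SubChoice_isSubLmodule of sub_sort N by <:].

Lemma sub_val_sum (R : realType) (V : vertex_superalgebra R)
    (M : weak_module V) (N : submodule M) (I : Type) (s : seq I)
    (f : I -> sub_sort N) :
  sub_val (\sum_(i <- s) f i) = \sum_(i <- s) sub_val (f i).
Proof. exact: (raddf_sum (\val : sub_sort N -> M)). Qed.

Lemma sub_in (R : realType) (V : vertex_superalgebra R)
    (M : weak_module V) (N : submodule M) (x : sub_sort N) : sub_set N (sub_val x).
Proof. exact/sub_predP/sub_valP. Qed.

Definition to_sub (R : realType) (V : vertex_superalgebra R)
    (M : weak_module V) (N : submodule M) (x : M) (Nx : sub_set N x) :
    sub_sort N := SubSort (introT (sub_predP N x) Nx).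

Definition sub_par (R : realType) (V : vertex_superalgebra R)
    (M : weak_module V) (N : submodule M) (p : bool) : set (sub_sort N) :=
  [set x | par p (sub_val x)].

Lemma sub_par_direct (R : realType) (V : vertex_superalgebra R)
    (M : weak_module V) (N : submodule M) : is_direct_sum (sub_par (N := N)).
Proof.
have [subM _ freeM] := par_direct M; split.
- move=> p; have [p0 pL] := subM p; split; first exact: p0.
  by move=> a x y px py; apply: (pL a _ _ px py).
- move=> w; have [w0 [w1 [N0 p0 N1 p1 Ew]]] := sub_graded (sub_in w).
  exists [:: false; true], (fun b => if b then to_sub N1 else to_sub N0).
  split; first by case.
  by apply: val_inj; rewrite /= !big_cons big_nil addr0.
- move=> s f us fp /(congr1 (@sub_val R V M N)); rewrite sub_val_sum => E i si.
  by apply: val_inj; apply: (freeM s (@sub_val R V M N \o f)).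
Qed.

Definition sub_act (R : realType) (V : vertex_superalgebra R)
    (M : weak_module V) (N : submodule M) (v : V) (n : int)
    (w : Superspace (sub_par_direct N)) : Superspace (sub_par_direct N) :=
  to_sub (sub_stable v n (sub_in w)).

Lemma sub_act_linl (R : realType) (V : vertex_superalgebra R)
    (M : weak_module V) (N : submodule M) n w :
  linear (fun v => @sub_act R V M N v n w).
Proof. by move=> a u v; apply: val_inj; apply: act_linl. Qed.

Lemma sub_act_linr (R : realType) (V : vertex_superalgebra R)
    (M : weak_module V) (N : submodule M) v n : linear (@sub_act R V M N v n).
Proof.
by move=> a x y; apply: val_inj; apply: act_linr.
Qed.

Lemma sub_act_trunc (R : realType) (V : vertex_superalgebra R)
    (M : weak_module V) (N : submodule M) v w :
  exists K : int, forall n, K <= n -> @sub_act R V M N v n w = 0.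
Proof.
have [K trK] := act_trunc v (sub_val w); exists K => n leKn.
by apply: val_inj; apply: trK.
Qed.

Lemma sub_act_vac (R : realType) (V : vertex_superalgebra R)
    (M : weak_module V) (N : submodule M) n w :
  @sub_act R V M N vac n w = if n == -1 then w else 0.
Proof.
by apply: val_inj; rewrite /= act_vac; case: ifP.
Qed.

Lemma sub_act_jacobi (R : realType) (V : vertex_superalgebra R)
    (M : weak_module V) (N : submodule M) :
  jacobi_identity mode (@sub_act R V M N).
Proof.
move=> p q u v w l m n pu qv.
have [N0 JN] := act_jacobi (sub_val w) l m n pu qv; exists N0 => K leK.
by apply: val_inj; rewrite /= !sub_val_sum; apply: JN.
Qed.

Definition submodule_module (R : realType) (V : vertex_superalgebra R)
    (M : weak_module V) (N : submodule M) : weak_module V :=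
  WeakModule (@sub_act_linl R V M N) (@sub_act_linr R V M N)
    (fun p q v n w => @act_par R V M p q v n (sub_val w)) (@sub_act_trunc R V M N)
    (@sub_act_vac R V M N) (@sub_act_jacobi R V M N).

Definition irreducible_module (R : realType) (V : vertex_superalgebra R)
    (M : weak_module V) : Prop :=
  (exists w : M, w <> 0) /\
  forall N : submodule M, sub_set N = [set 0] \/ sub_set N = setT.

Definition isomorphic_modules (R : realType) (V : vertex_superalgebra R)
    (M N : weak_module V) : Prop :=
  exists f : M -> N,
    [/\ linear f, bijective f, forall p w, par p w -> par p (f w)
      & forall v n w, f (act v n w) = act v n (f w)].

Definition sum_of_irreducibles (R : realType) (V : vertex_superalgebra R)
    (M : weak_module V) : Prop :=
  exists (I : choiceType) (N : I -> submodule M),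
    is_direct_sum (fun i => sub_set (N i)) /\
    forall i, irreducible_module (submodule_module (N i)).

(* A subcategory of the category of weak modules is given by its class of
   objects: semisimplicity only concerns objects. *)
Definition semisimple_category (R : realType) (V : vertex_superalgebra R)
    (C : weak_module V -> Prop) : Prop :=
  forall M, C M -> sum_of_irreducibles M.

Definition closed_under_submodules (R : realType) (V : vertex_superalgebra R)
    (C : weak_module V -> Prop) : Prop :=
  forall M, C M -> forall N : submodule M, C (submodule_module N).

(* [weight_*] below: V_r is the r-eigenspace of L(0) = omega_(1).  The grading
   requires L(0) = r on V_r, and eigenspaces for distinct r are independent, so
   the homogeneous components are the full eigenspaces. *)
Definition eigenspace0 (K : fieldType) (W : lmodType K) (f : W -> W) (a : K) :
    set W := [set w | f w = a *: w].

Record vertex_operator_superalgebra (R : realType) :=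
    VertexOperatorSuperalgebra {
  vo_alg :> vertex_superalgebra R;
  omega : vo_alg;
  central_charge : R[i];
  omega_even : par false omega;
  virasoro : forall (m n : int) (v : vo_alg),
    let L (k : int) := mode omega (k + 1) in
    L m (L n v) - L n (L m v) = (m - n)%:~R *: L (m + n) v +
      (if m + n == 0 then ((m ^+ 3 - m)%:~R / 12%:R * central_charge) *: v
       else 0);
  virasoro_transl : forall v : vo_alg, mode omega 0 v = transl v;
  weight_direct : is_direct_sum (fun r : rat =>
    eigenspace0 (mode omega 1) (ratr r));
  weight_fin_dim : forall r : rat, fin_dim (eigenspace0 (mode omega 1) (ratr r));
  weight_bounded : exists r0 : rat, forall r : rat, r < r0 ->
    eigenspace0 (mode omega 1) (ratr r) = [set 0]
}.
Arguments omega {R v0}.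

(* A vertex operator algebra is a purely even vertex operator superalgebra. *)
Definition purely_even (R : realType) (V : superspace R) : Prop :=
  par (s := V) false = setT.

(* V is simple if it is irreducible as a module over itself. *)
Definition simple_vsa (R : realType) (V : vertex_superalgebra R) : Prop :=
  irreducible_module (adjoint_module V).

Definition ordinary_module (R : realType) (V : vertex_operator_superalgebra R)
    (M : weak_module V) : Prop :=
  let weight (a : R[i]) : set M := eigenspace0 (act (omega (v0 := V)) 1) a in
  [/\ is_direct_sum weight,
      forall a, fin_dim (weight a)
    & exists r0 : R, forall a : R[i], complex.Re a < r0 -> weight a = [set 0]].

(* V as a subalgebra of U, through an inclusion map. *)
Record subalgebra (R : realType) (V U : vertex_superalgebra R) := Subalgebra {
  incl :> V -> U;
  incl_linear : linear incl;
  incl_inj : injective incl;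
  incl_par : forall p v, par p v -> par p (incl v);
  incl_vac : incl vac = vac;
  incl_mode : forall u n v, incl (mode u n v) = mode (incl u) n (incl v)
}.

Lemma restrict_linl (R : realType) (V U : vertex_superalgebra R)
    (iota : subalgebra V U) (M : weak_module U) n (w : M) :
  linear (fun v => act (iota v) n w).
Proof. by move=> a u v; rewrite incl_linear act_linl. Qed.

Lemma restrict_vac (R : realType) (V U : vertex_superalgebra R)
    (iota : subalgebra V U) (M : weak_module U) n (w : M) :
  act (iota vac) n w = if n == -1 then w else 0.
Proof. by rewrite incl_vac act_vac. Qed.

Lemma restrict_jacobi (R : realType) (V U : vertex_superalgebra R)
    (iota : subalgebra V U) (M : weak_module U) :
  jacobi_identity mode (fun v => act (w0 := M) (iota v)).
Proof.
move=> p q u v w l m n pu qv.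
have [N0 JN] := act_jacobi w l m n (incl_par iota pu) (incl_par iota qv).
exists N0 => K /JN <-; apply: eq_bigr => i _; by rewrite incl_mode.
Qed.

(* A weak U-module viewed as a weak V-module. *)
Definition restrict_module (R : realType) (V U : vertex_superalgebra R)
    (iota : subalgebra V U) (M : weak_module U) : weak_module V :=
  WeakModule (@restrict_linl R V U iota M) (fun v => act_linr (iota v))
    (fun p q v n w pv => @act_par R U M p q (iota v) n w (incl_par iota pv))
    (fun v => act_trunc (iota v)) (@restrict_vac R V U iota M)
    (@restrict_jacobi R V U iota M).

Definition mode_span (R : realType) (U : vertex_superalgebra R) (A B : set U) :
    set U :=
  lin_span [set x | exists (u w : U) (n : int), [/\ A u, B w & x = mode u n w]].

(* Main.v *)
(* Write V^1 S for the span of the u_(n) w with u in V^1 and w in S, for a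
   V-submodule S of a weak U-module M.  The Jacobi identity makes this product
   associative, and V^1 V^1 = V since V is simple, so V^1 (V^1 S) = S; hence
   S |-> V^1 S preserves irreducibility over V.  If S is irreducible over V,
   then either V^1 S = S, and S is an irreducible U-module, or the sum of S and
   V^1 S is direct.  In the latter case a proper nonzero U-submodule N of the
   sum is the graph of a bijection from S to V^1 S; the involution which is 1
   on S and -1 on V^1 S maps N to another irreducible U-submodule, and
   2 a = (a + b) + (a - b) shows that S lies in the sum of the two.  So every
   irreducible V-submodule of M lies in the sum of the irreducible
   U-submodules, and Zorn's lemma makes that sum direct. *)
Require Import Defs.
From mathcomp Require Import all_boot all_order all_algebra.
From mathcomp Require Import boolp classical_sets reals.
From mathcomp Require Import complex.
From mathcomp Require Import zify.

Set Implicit Arguments.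
Unset Strict Implicit.
Unset Printing Implicit Defensive.

Import Order.TTheory GRing.Theory Num.Theory.

Local Open Scope classical_set_scope.
Local Open Scope ring_scope.

(** * Subspaces and linear spans *)

Section Subspaces.
Variables (K : fieldType) (W : lmodType K).
Implicit Types S A : set W.

Lemma subspaceD S x y : is_subspace S -> S x -> S y -> S (x + y).
Proof. by move=> [_ SL] Sx Sy; rewrite -[x]scale1r; apply: SL. Qed.

Lemma subspaceZ S a x : is_subspace S -> S x -> S (a *: x).
Proof. by move=> [S0 SL] Sx; rewrite -[_ *: _]addr0; apply: SL. Qed.

Lemma subspaceB S x y : is_subspace S -> S x -> S y -> S (x - y).
Proof.
by move=> subS Sx Sy; rewrite -scaleN1r; apply: subspaceD => //; apply: subspaceZ.
Qed.

Lemma subspace_sum S (I : eqType) (r : seq I) (P : pred I) (F : I -> W) :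
  is_subspace S -> (forall i, i \in r -> P i -> S (F i)) ->
  S (\sum_(i <- r | P i) F i).
Proof.
move=> subS SF; rewrite big_seq_cond; elim/big_ind: _ => [|x y|i /andP[]].
- by case: subS.
- exact: subspaceD.
- exact: SF.
Qed.

Lemma subspace0 : is_subspace ([set 0] : set W).
Proof. by split=> // a x y -> ->; rewrite /= scaler0 addr0. Qed.

Lemma linear_fun0 (W' : lmodType K) (f : W -> W') : linear f -> f 0 = 0.
Proof.
by move=> fL; have := fL (-1) 0 0; rewrite scaler0 addr0 scaleN1r addNr.
Qed.

Lemma linear_funD (W' : lmodType K) (f : W -> W') : linear f -> {morph f : x y / x + y}.
Proof. by move=> fL x y; rewrite -[x]scale1r fL !scale1r. Qed.

Lemma linear_funB (W' : lmodType K) (f : W -> W') : linear f -> {morph f : x y / x - y}.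
Proof. by move=> fL x y; rewrite addrC -scaleN1r fL scaleN1r addrC. Qed.

Lemma mem_lin_span A : A `<=` lin_span A.
Proof.
move=> x Ax; exists 1%N, (fun=> 1), (fun=> x); split=> //.
by rewrite big_ord1 scale1r.
Qed.

Lemma lin_span_min A S : is_subspace S -> A `<=` S -> lin_span A `<=` S.
Proof.
move=> subS AS x [n [c [e [Ae ->]]]]; apply: subspace_sum => // i _ _.
by apply: subspaceZ => //; apply: AS.
Qed.

Lemma lin_span_subspace A : is_subspace (lin_span A).
Proof.
split=> [|a x y [m [c [e [Ae ->]]]] [n [d [g [Ag ->]]]]].
  exists 0%N, (fun=> 0), (fun=> 0); split; first by case.
  by rewrite big_ord0.
exists (m + n)%N, (fun i => match split i with inl j => a * c j | inr j => d j end),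
  (fun i => match split i with inl j => e j | inr j => g j end).
split=> [i|]; first by case: split.
rewrite big_split_ord /= scaler_sumr; congr (_ + _); apply: eq_bigr => i _.
  by rewrite -[lshift _ _]/(unsplit (inl _)) unsplitK scalerA.
by rewrite -[rshift _ _]/(unsplit (inr _)) unsplitK.
Qed.

End Subspaces.

Lemma lin_span_linear_image (K : fieldType) (W W' : lmodType K) (f : W -> W')
    (A : set W) (S : set W') :
  linear f -> is_subspace S -> (forall x, A x -> S (f x)) ->
  forall x, lin_span A x -> S (f x).
Proof.
move=> fL subS AS; apply: lin_span_min => //; split=> [|a x y Sx Sy].
  by rewrite /= (linear_fun0 fL); case: subS.
by rewrite /= fL; case: subS => _; apply.
Qed.

(** * Parity decompositions and graded subsets *)

Section Graded.
Variables (R : realType) (M : superspace R).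
Implicit Types S A : set M.

Definition graded S : Prop :=
  forall w, S w -> exists w0 w1,
    [/\ S w0, par false w0, S w1, par true w1 & w = w0 + w1].

Lemma par_subspace p : is_subspace (par (s := M) p).
Proof. by case: (par_direct M). Qed.

Lemma par_decomp (w : M) :
  exists w0 w1, [/\ par false w0, par true w1 & w = w0 + w1].
Proof.
have [subM /(_ w) [s [f [pf ->]]] _] := par_direct M.
exists (\sum_(i <- s | ~~ i) f i), (\sum_(i <- s | i) f i); split.
- by apply: subspace_sum => // -[].
- by apply: subspace_sum => // -[].
- by rewrite (bigID (fun i : bool => i)) addrC.
Qed.

Lemma par_decomp_uniq (x0 x1 y0 y1 : M) :
  par false x0 -> par true x1 -> par false y0 -> par true y1 ->
  x0 + x1 = y0 + y1 -> x0 = y0 /\ x1 = y1.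
Proof.
move=> px0 px1 py0 py1 E.
have [_ _ free] := par_direct M.
have H : forall i, i \in [:: false; true] ->
    (if i then x1 - y1 else x0 - y0) = 0.
  apply: (free [:: false; true]) => // [[]|].
  - exact: subspaceB (par_subspace _) px1 py1.
  - exact: subspaceB (par_subspace _) px0 py0.
  - by rewrite !big_cons big_nil addr0 addrACA -opprD E subrr.
by split; apply/eqP; rewrite -subr_eq0; apply/eqP;
  [apply: (H false)|apply: (H true)].
Qed.

Lemma graded_components S x0 x1 :
  graded S -> par false x0 -> par true x1 -> S (x0 + x1) -> S x0 /\ S x1.
Proof.
move=> gS p0 p1 /gS [y0 [y1 [Sy0 q0 Sy1 q1 E]]].
by have [-> ->] := par_decomp_uniq p0 p1 q0 q1 E.
Qed.

Lemma gradedI S A : graded S -> graded A -> graded (S `&` A).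
Proof.
move=> gS gA w [Sw Aw]; have [w0 [w1 [p0 p1 E]]] := par_decomp w.
rewrite {}E in Sw Aw *.
have [? ?] := graded_components gS p0 p1 Sw.
have [? ?] := graded_components gA p0 p1 Aw.
by exists w0, w1.
Qed.

(** The vectors whose two parity components lie in [lin_span A] form a subspace, which contains [A]
    by hypothesis. *)
Lemma graded_span A :
  (forall w, A w -> exists w0 w1, [/\ lin_span A w0, par false w0,
     lin_span A w1, par true w1 & w = w0 + w1]) ->
  graded (lin_span A).
Proof.
move=> gA; have [S0 SL] := lin_span_subspace A.
have [p00 p0L] := par_subspace false; have [p10 p1L] := par_subspace true.
apply: lin_span_min => //; split; first by exists 0, 0; split; rewrite ?addr0.
move=> a _ _ [x0 [x1 [Sx0 px0 Sx1 px1 ->]]] [y0 [y1 [Sy0 py0 Sy1 py1 ->]]].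
exists (a *: x0 + y0), (a *: x1 + y1).
by split; rewrite ?scalerDr 1?addrACA; auto.
Qed.

End Graded.

(** * Submodules and irreducibility in terms of subsets *)

Section Submodules.
Variables (R : realType) (U : vertex_superalgebra R) (M : weak_module U).
Implicit Types (A B : set U) (S T : set M).

(** The acting set [A] is a parameter, so that U-submodules ([A = setT]) and V-submodules ([A] the
    image of V) are subsets of one space and can be intersected and compared. *)
Definition submod A S : Prop :=
  [/\ is_subspace S, graded S & forall u n w, A u -> S w -> S (act u n w)].

Definition simple_submod A S : Prop :=
  [/\ submod A S, S <> [set 0] & forall T, submod A T -> T `<=` S ->
     T = [set 0] \/ T = S].

Definition submodule_of S (sS : submod setT S) : submodule M :=
  let: And3 subS gS aS := sS in Submodule subS gS (fun v n w => aS v n w I).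

Lemma submodule_ofE S (sS : submod setT S) : sub_set (submodule_of sS) = S.
Proof. by case: sS. Qed.

Lemma submodule_submod (N : submodule M) : submod setT (sub_set N).
Proof.
by split; [exact: sub_subspace|exact: sub_graded|move=> v n w _; apply: sub_stable].
Qed.

Lemma submod_sub A B S : A `<=` B -> submod B S -> submod A S.
Proof. by move=> AB [? ? BS]; split=> // u n w /AB; apply: BS. Qed.

Lemma act0 (u : U) n : act u n (0 : M) = 0.
Proof. exact/linear_fun0/act_linr. Qed.

Lemma submodI A S T : submod A S -> submod A T -> submod A (S `&` T).
Proof.
move=> [[S0 SL] gS aS] [[T0 TL] gT aT]; split.
- by split=> // a x y [? ?] [? ?]; split; [apply: SL|apply: TL].
- exact: gradedI.
- by move=> u n w Au [? ?]; split; [apply: aS|apply: aT].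
Qed.

(** The intersection is a submodule of [S], hence zero or all of [S]. *)
Lemma simple_submod_meet A S T :
  simple_submod A S -> submod A T -> T `&` S = [set 0] \/ S `<=` T.
Proof.
move=> [sS _ minS] sT.
case: (minS (T `&` S)) => [|x [] //||/setIidPr]; [exact: submodI| |]; tauto.
Qed.

End Submodules.

(** Preimage and image under [sub_val] match the submodules of [submodule_module N] with the
    submodules of [M] contained in [N]. *)
Lemma irreducible_simple_submod (R : realType) (U : vertex_superalgebra R)
    (M : weak_module U) (N : submodule M) :
  irreducible_module (submodule_module N) <-> simple_submod setT (sub_set N).
Proof.
have [subN gN aN] := submodule_submod N; split.
- move=> [[w w_neq0] minN]; split; first exact: submodule_submod.
    move=> N0; apply: w_neq0; apply: val_inj.
    by have := sub_in w; rewrite N0.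
  move=> T [subT gT aT] TN.
  pose T' : set (submodule_module N) := [set x | T (sub_val x)].
  have sT' : submod setT T'.
    split.
    + by case: subT => T0 TL; split=> [|a x y Tx Ty] //; apply: TL.
    + move=> w' /gT [w0 [w1 [T0 p0 T1 p1 E]]].
      exists (to_sub (TN _ T0)), (to_sub (TN _ T1)); split=> //.
      exact: val_inj.
    + by move=> u n x _ Tx; apply: aT.
  case: (minN (submodule_of sT')); rewrite submodule_ofE => T'E;
    [left|right]; apply/seteqP; split=> x //.
  + move=> Tx; have : T' (to_sub (TN _ Tx)) by [].
    by rewrite T'E => /(congr1 (@sub_val _ _ _ _)).
  + by move=> ->; case: subT.
  + exact: TN.
  + move=> Nx; have : T' (to_sub Nx) by rewrite T'E.
    by [].
- move=> [_ N_neq0 minN]; split.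
    apply: contrapT => now; apply: N_neq0; apply/seteqP.
    split=> x; last by move=> ->; case: subN.
    move=> Nx; apply: contrapT => /= x_neq0; apply: now; exists (to_sub Nx).
    by move=> /(congr1 (@sub_val _ _ _ _)).
  move=> L; pose T : set M := [set x | exists y, sub_set L y /\ x = sub_val y].
  have [[L0 LL] gL aL] := submodule_submod L.
  have sT : submod setT T.
    split.
    + split; first by exists 0.
      move=> a _ _ [x [Lx ->]] [y [Ly ->]].
      by exists (a *: x + y); split=> //; apply: LL.
    + move=> _ [x [/gL [x0 [x1 [L0' p0 L1 p1 ->]]] ->]].
      by exists (sub_val x0), (sub_val x1); split=> //; [exists x0|exists x1].
    + by move=> u n _ _ [x [Lx ->]]; exists (act u n x); split=> //; apply: aL.
  case: (minN T sT) => [_ [x [_ ->]]||]; [exact: sub_in| |] => TE; [left|right];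
    apply/seteqP; split=> x //.
  + move=> Lx; apply: val_inj; have : T (sub_val x) by exists x.
    by rewrite TE.
  + by move=> ->.
  + move=> _; have : T (sub_val x) by rewrite TE; apply: sub_in.
    by move=> [y [Ly /val_inj ->]].
Qed.

(** * Associativity of the action, from the Jacobi identity *)

Lemma binomz_n0 (K : fieldType) (m : int) : binomz K m 0 = 1.
Proof. by rewrite /binomz big_ord0 divr1. Qed.

Lemma binomz_0S (K : fieldType) (k : nat) : binomz K 0 k.+1 = 0.
Proof. by rewrite /binomz big_ord_recl subrr !mul0r. Qed.

Section Associativity.
Variables (R : realType) (U : vertex_superalgebra R) (M : weak_module U).
Variables (S : set M).
Hypothesis subS : is_subspace S.

(* In the Jacobi identity choose the middle index [m] so large that
   [u_(m+i) w = 0]: only the products u_(j) v_(k) w remain on the right, and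
   those other than the leading one have a larger index [k]. *)
Lemma homogeneous_act_act p q (u v : U) (w : M) :
  par p u -> par q v -> (forall a b, S (act (mode u a v) b w)) ->
  forall m n, S (act u m (act v n w)).
Proof.
move=> pu qv Suv.
have [K1 trv] := act_trunc v w; have [K2 tru] := act_trunc u w.
(* Since [v_(n) w = 0] for [n >= K1], the induction is on a bound [k] for the distance from [n] up
   to [K1]. *)
suff H k : forall m n, K1 - n <= k%:Z -> S (act u m (act v n w)).
  by move=> m n; apply: (H `|K1 - n|%N); lia.
elim: k => [|k IH] m n le_n.
  by rewrite trv ?act0; [case: subS|lia].
(* The first index [m - K2] makes the leading term on the right [act u m (act v n w)]. *)
have [N0 /(_ N0.+1 (leqnSn _))] := act_jacobi w (m - K2) K2 n pu qv.
rewrite [RHS]big_ord_recl /= expr0 binomz_n0 mulr1 scale1r (tru (K2 + 0)) ?addr0 //.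
rewrite act0 scaler0 subr0 subrK => /esym/(canRL (addrK _)) ->.
apply: subspaceB => //; apply: subspace_sum => // i _ _; apply: subspaceZ => //.
rewrite (tru (K2 + _)) ?act0 ?scaler0 ?subr0; last by lia.
by apply: IH; rewrite /bump /=; lia.
Qed.

(** With middle index 0 the binomials [binomz 0 i] vanish for [i > 0], so the left side of the
    Jacobi identity is the single term [(u_(a) v)_(b) w], while the right side involves only
    products of two modes. *)
Lemma homogeneous_act_mode p q (u v : U) (w : M) :
  par p u -> par q v -> (forall m n, S (act u m (act v n w))) ->
  (forall m n, S (act v m (act u n w))) ->
  forall a b, S (act (mode u a v) b w).
Proof.
move=> pu qv Suv Svu a b.
have [N0 /(_ N0.+1 (leqnSn _))] := act_jacobi w a 0 b pu qv.
rewrite [LHS]big_ord_recl /= binomz_n0 scale1r addr0 add0r subr0.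
rewrite [X in _ + X]big1 ?addr0 => [->|i _]; last by rewrite binomz_0S scale0r.
apply: subspace_sum => // i _ _; apply: subspaceZ => //; apply: subspaceB => //.
exact: subspaceZ.
Qed.

(** The parity components of [u] and [v] stay in the graded sets [A] and [B], which reduces this
    lemma and the next to homogeneous vectors. *)
Lemma act_act_in A B (w : M) : graded A -> graded B ->
  (forall u v a b, A u -> B v -> S (act (mode u a v) b w)) ->
  forall u v m n, A u -> B v -> S (act u m (act v n w)).
Proof.
move=> gA gB SAB u v m n.
move=> /gA [u0 [u1 [A0 p0 A1 p1 ->]]] /gB [v0 [v1 [B0 q0 B1 q1 ->]]].
rewrite (linear_funD (act_linl _ _)) (linear_funD (act_linl _ _)).
rewrite !(linear_funD (act_linr _ _)).
by do 2?apply: subspaceD => //; apply: homogeneous_act_act; eauto.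
Qed.

Lemma act_mode_in A B (w : M) : graded A -> graded B ->
  (forall u v m n, A u -> B v -> S (act u m (act v n w))) ->
  (forall u v m n, A u -> B v -> S (act v m (act u n w))) ->
  forall u v a b, A u -> B v -> S (act (mode u a v) b w).
Proof.
move=> gA gB SAB SBA u v a b.
move=> /gA [u0 [u1 [A0 p0 A1 p1 ->]]] /gB [v0 [v1 [B0 q0 B1 q1 ->]]].
rewrite (linear_funD (mode_linl _ _)) !(linear_funD (mode_linr _ _)).
rewrite !(linear_funD (act_linl _ _)).
by do 2?apply: subspaceD => //; apply: homogeneous_act_mode; eauto.
Qed.

End Associativity.

(** * Products A S and the socle *)

Section ActSpan.
Variables (R : realType) (U : vertex_superalgebra R) (M : weak_module U).
Implicit Types (A B : set U) (S T : set M).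

Definition act_span A S : set M :=
  lin_span [set x | exists u n w, [/\ A u, S w & x = act u n w]].

Lemma mem_act_span A S u n w : A u -> S w -> act_span A S (act u n w).
Proof. by move=> Au Sw; apply: mem_lin_span; exists u, n, w. Qed.

Lemma act_span_min A S T : is_subspace T ->
  (forall u n w, A u -> S w -> T (act u n w)) -> act_span A S `<=` T.
Proof.
by move=> subT AST; apply: lin_span_min => // _ [u [n [w [? ? ->]]]]; apply: AST.
Qed.

Lemma act_span_subspace A S : is_subspace (act_span A S).
Proof. exact: lin_span_subspace. Qed.

Lemma act_spanS A S T : S `<=` T -> act_span A S `<=` act_span A T.
Proof.
move=> ST; apply: act_span_min; first exact: act_span_subspace.
by move=> u n w Au /ST; apply: mem_act_span.
Qed.

(** Parities add: even-even and odd-odd products give the even component, mixed products the odd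
    one. *)
Lemma act_span_graded A S : graded A -> graded S -> graded (act_span A S).
Proof.
move=> gA gS; apply: graded_span => _ [u [n [w [Au Sw ->]]]].
have [u0 [u1 [A0 p0 A1 p1 ->]]] := gA _ Au.
have [w0 [w1 [S0 q0 S1 q1 ->]]] := gS _ Sw.
have subAS := act_span_subspace A S.
exists (act u0 n w0 + act u1 n w1), (act u1 n w0 + act u0 n w1); split.
- by apply: subspaceD => //; apply: mem_act_span.
- by apply: subspaceD; [exact: par_subspace|exact: act_par p0 q0|exact: act_par p1 q1].
- by apply: subspaceD => //; apply: mem_act_span.
- by apply: subspaceD; [exact: par_subspace|exact: act_par p1 q0|exact: act_par p0 q1].
- rewrite (linear_funD (act_linl _ _)) !(linear_funD (act_linr _ _)).
  by rewrite addrACA [RHS]addrACA [act u0 n w1 + _]addrC.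
Qed.

(** Associativity for products of sets: A (B S) lies in (A B) S, with [C] a bound for A B and [T] a
    bound for C S. *)
Lemma act_span_mode A B C S T : is_subspace T -> graded A -> graded B ->
  (forall u v a, A u -> B v -> C (mode u a v)) ->
  (forall u n w, C u -> S w -> T (act u n w)) ->
  forall u n w, A u -> act_span B S w -> T (act u n w).
Proof.
move=> subT gA gB ABC CST u n w Au.
apply: lin_span_linear_image => // [|_ [v [m [x [Bv Sx ->]]]]]; first exact: act_linr.
apply: (act_act_in subT gA gB) => // u' v' a b Au' Bv'.
by apply: CST => //; apply: ABC.
Qed.

(** The sum of the irreducible U-submodules; semisimplicity of [M] amounts to its being all of
    [M]. *)
Definition socle : set M := lin_span [set x | exists2 S, simple_submod setT S & S x].

Lemma simple_sub_socle S : simple_submod setT S -> S `<=` socle.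
Proof. by move=> sS x Sx; apply: mem_lin_span; exists S. Qed.

End ActSpan.

Arguments socle {R U} M.

(** * The operation taking S to V^1 S on V-submodules *)

(* [A0] and [A1] are the summands of U = V (+) V^1. *)
Section Twist.
Variables (R : realType) (U : vertex_superalgebra R) (M : weak_module U).
Variables (A0 A1 : set U).
Hypotheses (gA0 : graded A0) (gA1 : graded A1).
Hypothesis A01 : forall u n v, A0 u -> A1 v -> A1 (mode u n v).
Hypothesis A11 : forall u n v, A1 u -> A1 v -> A0 (mode u n v).
Hypothesis A_sum : forall u, exists u0 u1, [/\ A0 u0, A1 u1 & u = u0 + u1].
(** The form in which V^1 V^1 = V is used: a vector [w] is recovered as the vacuum acting on it. *)
Hypothesis vac_A11 : mode_span A1 A1 vac.
Implicit Types S T : set M.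

(** V (V^1 S) lies in (V V^1) S, which lies in V^1 S. *)
Lemma act_span_submod S : submod A0 S -> submod A0 (act_span A1 S).
Proof.
move=> [subS gS aS]; split; [exact: act_span_subspace|exact: act_span_graded|].
apply: (act_span_mode (C := A1)) => //; first exact: act_span_subspace.
  by move=> u v a; apply: A01.
by move=> u n w; apply: mem_act_span.
Qed.

(** On one side V^1 (V^1 S) lies in (V^1 V^1) S, hence in V S and in S. On the other, [w] is
    [act vac (-1) w], the vacuum is a combination of modes [u_(n) v] with [u], [v] in V^1, and these
    act through products of two modes from V^1. *)
Lemma act_spanK S : submod A0 S -> act_span A1 (act_span A1 S) = S.
Proof.
move=> [subS gS aS]; apply/seteqP; split.
  apply: act_span_min => //; apply: (act_span_mode (C := A0)) => // u v a.
  exact: A11.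
move=> w Sw; have subSS := act_span_subspace A1 (act_span A1 S).
have -> : w = act vac (-1) w by rewrite act_vac eqxx.
apply: (lin_span_linear_image (act_linl (-1) w) subSS _ vac_A11).
move=> _ [u [v [n [Au Av ->]]]].
by apply: (act_mode_in subSS gA1 gA1) => // {u v n Au Av} u v m n Au Av;
  do 2!apply: mem_act_span => //.
Qed.

Lemma act_span_eq0 S : submod A0 S -> act_span A1 S = [set 0] -> S = [set 0].
Proof.
move=> sS S0; rewrite -(act_spanK sS) S0; apply/seteqP; split.
  by apply: act_span_min => [|u n w _ ->]; [exact: subspace0|exact: act0].
by move=> _ ->; case: (act_span_subspace A1 [set 0 : M]).
Qed.

(** The operation is an inclusion-preserving involution: a submodule T of V^1 S gives the submodule
    V^1 T of S, which is zero or S, and applying V^1 again recovers T. *)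
Lemma act_span_simple S :
  simple_submod A0 S -> simple_submod A0 (act_span A1 S).
Proof.
move=> [sS S_neq0 minS]; split; first exact: act_span_submod.
  by move=> /act_span_eq0 -/(_ sS).
move=> T sT TS.
have := minS _ (act_span_submod sT).
rewrite -[X in _ `<=` X](act_spanK sS).
case=> [|/act_span_eq0 -> //|<-]; [exact: act_spanS|by left|right].
by rewrite act_spanK.
Qed.

Lemma submodT_of S : is_subspace S -> graded S ->
  (forall u n w, A0 u -> S w -> S (act u n w)) ->
  (forall u n w, A1 u -> S w -> S (act u n w)) -> submod setT S.
Proof.
move=> subS gS a0 a1; split=> // u n w _ Sw.
have [u0 [u1 [Au0 Au1 ->]]] := A_sum u.
by rewrite (linear_funD (act_linl _ _)); apply: subspaceD; auto.
Qed.

Lemma act_span_sub S T : submod setT T -> S `<=` T -> act_span A1 S `<=` T.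
Proof.
by move=> [subT _ aT] ST; apply: act_span_min => // u n w _ /ST; apply: aT.
Qed.

(** Being nonzero inside the irreducible V^1 S, [S] equals it; so V^1 preserves [S], which is then a
    U-submodule, irreducible already over V. *)
Lemma socle_of_self_twisted S :
  simple_submod A0 S -> S `<=` act_span A1 S -> S `<=` socle M.
Proof.
move=> simS Stw; apply: simple_sub_socle.
have [[subS gS aS] S_neq0 minS] := simS.
have [_ _ /(_ _ (And3 subS gS aS) Stw) [//|ES]] := act_span_simple simS.
split=> // [|T sT TS]; last by apply: minS => //; apply: submod_sub sT.
by apply: submodT_of => // u n w Au Sw; rewrite ES; apply: mem_act_span.
Qed.

(** * The case where S and T = V^1 S meet in zero *)

Section Diagonal.
Variables S : set M.
Let T := act_span A1 S.
Hypothesis simS : simple_submod A0 S.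
Hypothesis ST0 : S `&` T = [set 0].

Let sS : submod A0 S. Proof. by case: simS. Qed.
Let simT : simple_submod A0 T. Proof. exact: act_span_simple. Qed.
Let sT : submod A0 T. Proof. by case: simT. Qed.
Let ET : act_span A1 T = S. Proof. exact: act_spanK. Qed.

Let AST u n w : A1 u -> S w -> T (act u n w). Proof. exact: mem_act_span. Qed.
Let ATS u n w : A1 u -> T w -> S (act u n w).
Proof. by rewrite -ET; apply: mem_act_span. Qed.

(* [(e0, e1) = (1, 0)] gives the projection of [N] to [S], and [(1, -1)] its
   image under the involution. *)
Definition scaled (N : set M) (e0 e1 : R[i]) : set M :=
  [set x | exists a b, [/\ S a, T b, N (a + b) & x = e0 *: a + e1 *: b]].

(** Multiplication by [e0] on S and by [e1] on T is an even map commuting with V; [scaled N e0 e1]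
    is the image of the part of [N] in S + T. *)
Lemma scaled_submod0 N e0 e1 : submod A0 N -> submod A0 (scaled N e0 e1).
Proof.
have [[S0 SL] gS aS] := sS; have [[T0 TL] gT aT] := sT.
move=> [[N0 NL] gN aN]; split.
- split; first by exists 0, 0; rewrite !scaler0 !addr0.
  move=> c _ _ [a [b [Sa Tb Nab ->]]] [a' [b' [Sa' Tb' Nab' ->]]].
  exists (c *: a + a'), (c *: b + b'); split; auto.
    by rewrite addrACA -scalerDr; apply: NL.
  by rewrite !scalerDr !scalerA ![c * _]mulrC addrACA.
- move=> _ [a [b [/gS [a0 [a1 [Sa0 p0 Sa1 p1 ->]]]
    /gT [b0 [b1 [Tb0 q0 Tb1 q1 ->]]] Nab ->]]].
  rewrite addrACA in Nab.
  have subp p := @par_subspace R M p.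
  have [Nab0 Nab1] := graded_components gN (subspaceD (subp _) p0 q0)
    (subspaceD (subp _) p1 q1) Nab.
  exists (e0 *: a0 + e1 *: b0), (e0 *: a1 + e1 *: b1); split.
  + by exists a0, b0.
  + by apply: subspaceD => //; apply: subspaceZ.
  + by exists a1, b1.
  + by apply: subspaceD => //; apply: subspaceZ.
  + by rewrite !scalerDr addrACA.
- move=> u n _ Au [a [b [Sa Tb Nab ->]]].
  exists (act u n a), (act u n b); split; auto.
    by rewrite -(linear_funD (act_linr _ _)); apply: aN.
  have Z c x : act u n (c *: x) = c *: act u n x :> M.
    by rewrite -[c *: x]addr0 act_linr act0 addr0.
  by rewrite (linear_funD (act_linr _ _)) !Z.
Qed.

(** Elements of V^1 exchange S and T, so they anticommute with the involution; the sign is harmless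
    for a subspace. *)
Lemma scaled_submodT N : submod setT N -> submod setT (scaled N 1 (-1)).
Proof.
move=> sN; have [subN gN aN] := sN.
have [sub0 g0 a0] := scaled_submod0 1 (-1) (submod_sub (@subsetT _ _) sN).
apply: submodT_of => //.
- move=> u n _ Au [a [b [Sa Tb Nab ->]]].
  (* [act u n b] is in S and [act u n a] in T; the signs turn [act u n (a - b)] into the required
     difference of the two witnesses. *)
  exists (- act u n b), (- act u n a); split.
  + by rewrite -scaleN1r; apply: subspaceZ; [case: sS|apply: ATS].
  + by rewrite -scaleN1r; apply: subspaceZ; [case: sT|apply: AST].
  + rewrite -opprD -(linear_funD (act_linr _ _)) addrC -scaleN1r.
    by apply: subspaceZ => //; apply: aN.
  + by rewrite !scale1r !scaleN1r opprK (linear_funB (act_linr _ _)) addrC.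
Qed.

Let decomp_uniq a b a' b' :
  S a -> T b -> S a' -> T b' -> a + b = a' + b' -> a = a' /\ b = b'.
Proof.
move=> Sa Tb Sa' Tb' E.
have [subS _ _] := sS; have [subT _ _] := sT.
have E' : a - a' = b' - b.
  by apply/eqP; rewrite subr_eq addrAC eq_sym subr_eq E addrC.
have : (S `&` T) (a - a') by split; [|rewrite E']; apply: subspaceB.
rewrite ST0 => /= aa'; move: (E'); rewrite aa' => /esym bb'.
by split; apply/eqP; [rewrite -subr_eq0 aa'|rewrite eq_sym -subr_eq0 bb'].
Qed.

Definition twisted_sum : set M := [set x | exists a b, [/\ S a, T b & x = a + b]].

(** V preserves both summands and V^1 exchanges them. *)
Lemma twisted_sum_submod : submod setT twisted_sum.
Proof.
have [subS gS aS] := sS; have [subT gT aT] := sT.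
apply: submodT_of.
- split; first by exists 0, 0; split; [case: subS|case: subT|rewrite addr0].
  move=> c _ _ [a [b [Sa Tb ->]]] [a' [b' [Sa' Tb' ->]]].
  exists (c *: a + a'), (c *: b + b').
  by split; [case: subS => _; apply|case: subT => _; apply|rewrite scalerDr addrACA].
- move=> _ [a [b [/gS [a0 [a1 [Sa0 p0 Sa1 p1 ->]]]
    /gT [b0 [b1 [Tb0 q0 Tb1 q1 ->]]] ->]]].
  have subp p := @par_subspace R M p.
  exists (a0 + b0), (a1 + b1); split.
  + by exists a0, b0.
  + exact: subspaceD.
  + by exists a1, b1.
  + exact: subspaceD.
  + by rewrite addrACA.
- move=> u n _ Au [a [b [Sa Tb ->]]]; exists (act u n a), (act u n b).
  by split; [apply: aS|apply: aT|apply: linear_funD (act_linr _ _) _ _].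
- move=> u n _ Au [a [b [Sa Tb ->]]]; exists (act u n b), (act u n a).
  by split; [apply: ATS|apply: AST|rewrite addrC; apply: linear_funD (act_linr _ _) _ _].
Qed.

Let sumS : S `<=` twisted_sum.
Proof.
by move=> a Sa; exists a, 0; rewrite addr0; split=> //; case: sT => -[].
Qed.

Let sum_sub N : submod setT N -> S `<=` N \/ T `<=` N -> twisted_sum `<=` N.
Proof.
move=> sN STN; have [SN TN] : S `<=` N /\ T `<=` N.
  case: STN => [SN|TN]; split=> //; first exact: act_span_sub.
  by rewrite -ET; apply: act_span_sub.
have [subN _ _] := sN.
by move=> _ [a [b [/SN Na /TN Nb ->]]]; apply: subspaceD.
Qed.

(** * Proper nonzero U-submodules of S + T *)

Section Proper.
Variable N : set M.
Hypothesis sN : submod setT N.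
Hypothesis N_sub : N `<=` twisted_sum.
Hypothesis N_neq0 : N <> [set 0].
Hypothesis N_neqT : N <> twisted_sum.

Let sN0 : submod A0 N. Proof. by apply: submod_sub sN. Qed.

Let NS : N `&` S = [set 0].
Proof.
have [//|SN] := simple_submod_meet simS sN0.
by case: N_neqT; apply/seteqP; split=> //; apply: sum_sub => //; left.
Qed.

Let NT : N `&` T = [set 0].
Proof.
have [//|TN] := simple_submod_meet simT sN0.
by case: N_neqT; apply/seteqP; split=> //; apply: sum_sub => //; right.
Qed.

(** The projection of [N'] to S is a V-submodule of S. If it were zero, [N'] would lie in N and T,
    which meet in zero; so it is all of S. *)
Lemma proper_graph N' : submod A0 N' -> N' <> [set 0] -> N' `<=` N ->
  forall a, S a -> exists2 b, T b & N' (a + b).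
Proof.
move=> sN' N'_neq0 N'N.
have sP := scaled_submod0 1 0 sN'.
have [_ _ /(_ _ sP)] := simS.
case=> [_ [a [b [Sa _ _ ->]]]|P0|PS].
- by rewrite scale1r scale0r addr0.
- case: N'_neq0; apply/seteqP; split=> x; last first.
    by move=> ->; case: sN' => -[].
  move=> N'x; have [a [b [Sa Tb E]]] := N_sub (N'N _ N'x).
  have : scaled N' 1 0 a.
    by exists a, b; rewrite scale1r scale0r addr0 -E.
  rewrite P0 => /= a0; rewrite a0 add0r in E.
  suff : (N `&` T) x by rewrite NT.
  by split; [apply: N'N|rewrite E].
- move=> a; rewrite -PS => -[a' [b [Sa' Tb N'ab ->]]].
  by exists b => //; rewrite scale1r scale0r addr0.
Qed.

(** Given [a + b] in N, a nonzero [N'] contains some [a + b'] with the same [a]; then [b - b'] lies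
    in N and T, so it vanishes. *)
Lemma proper_simple : simple_submod setT N.
Proof.
split=> // N' sN' N'N; have [->|N'_neq0] := pselect (N' = [set 0]); first by left.
right; apply/seteqP; split=> // x Nx.
have [a [b [Sa Tb E]]] := N_sub Nx.
have sN'0 : submod A0 N' by apply: submod_sub sN'.
have [b' Tb' N'ab] := proper_graph sN'0 N'_neq0 N'N Sa.
have [subN _ _] := sN; have [subT _ _] := sT.
have : (N `&` T) (b - b').
  split; last exact: subspaceB.
  have -> : b - b' = x - (a + b') by rewrite E opprD addrACA subrr add0r.
  by apply: subspaceB => //; apply: N'N.
by rewrite NT => /= /eqP; rewrite subr_eq0 E => /eqP ->.
Qed.

Lemma scaled_sub : scaled N 1 (-1) `<=` twisted_sum.
Proof.
move=> _ [a [b [Sa Tb _ ->]]]; exists a, (- b).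
rewrite scale1r scaleN1r; split=> //.
by rewrite -scaleN1r; apply: subspaceZ => //; case: sT.
Qed.

(** If [a - b] is zero, then [a = b] lies in both S and T, so [a + b] is zero as well. *)
Lemma scaled_neq0 : scaled N 1 (-1) <> [set 0].
Proof.
move=> N'0; apply: N_neq0; apply/seteqP; split=> x; last first.
  by move=> ->; case: sN => -[].
move=> Nx; have [a [b [Sa Tb E]]] := N_sub Nx; subst x.
have : scaled N 1 (-1) (a - b) by exists a, b; rewrite scale1r scaleN1r.
rewrite N'0 => /= /eqP; rewrite subr_eq0 => /eqP ab.
have : (S `&` T) a by split=> //; rewrite ab.
by rewrite ST0 => /= a0; rewrite -ab a0 /= addr0.
Qed.

(** Otherwise each [a] in S is [a' - b] with [a' + b] in N; uniqueness of components gives [b = 0],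
    so [a] is in N and S, which meet in zero, and S would be zero. *)
Lemma scaled_neq_sum : scaled N 1 (-1) <> twisted_sum.
Proof.
move=> N'E; have [_ S_neq0 _] := simS; apply: S_neq0; apply/seteqP.
have [[S0 _] _ _] := sS; have subT : is_subspace T by case: sT.
split=> a; last by move=> ->.
move=> Sa; have := sumS Sa; rewrite -N'E => -[a' [b [Sa' Tb Nab]]].
rewrite scale1r scaleN1r -[a]addr0 => E.
have Tb' : T (- b) by rewrite -scaleN1r; apply: subspaceZ.
have T0 : T 0 by case: subT.
have [aa' /eqP] := decomp_uniq Sa T0 Sa' Tb' E.
rewrite eq_sym oppr_eq0 => /eqP b0.
suff : (N `&` S) a by rewrite NS addr0.
by split=> //; rewrite aa' -[a']addr0 -[X in _ + X]b0.
Qed.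

End Proper.

(** Either S + T is itself irreducible over U and contains S, or a proper nonzero submodule N and
    its image under the involution are two irreducible submodules whose sum contains S. *)
Lemma socle_of_disjoint_twist : S `<=` socle M.
Proof.
have [|/existsNP [N /not_implyP [sN /not_implyP [NT /not_orP [N_neq0 N_neqT]]]]] :=
  pselect (forall N, submod setT N -> N `<=` twisted_sum ->
             N = [set 0] \/ N = twisted_sum).
  move=> minT a Sa; apply: (@simple_sub_socle _ _ _ twisted_sum); last exact: sumS.
  split=> //; first exact: twisted_sum_submod.
  move=> sum0; have [_ S_neq0 _] := simS; apply: S_neq0; apply/seteqP.
  have [[S0 _] _ _] := sS.
  by split=> x; [move=> /sumS; rewrite sum0|move=> ->].
have simN := proper_simple sN NT N_neq0 N_neqT.
have simN' : simple_submod setT (scaled N 1 (-1)).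
  apply: proper_simple; [exact: scaled_submodT|exact: scaled_sub| |].
  - exact: scaled_neq0.
  - exact: scaled_neq_sum.
move=> a Sa.
have sN0 : submod A0 N by apply: submod_sub sN.
have [b Tb Nab] := proper_graph sN NT N_neqT sN0 N_neq0 (@subset_refl _ N) Sa.
have -> : a = 2^-1 *: ((a + b) + (a - b)).
  rewrite addrACA subrr addr0 -mulr2n -[a *+ 2]scaler_nat scalerA mulVf ?scale1r //.
  by rewrite pnatr_eq0.
have subsoc : is_subspace (socle M) by apply: lin_span_subspace.
apply: subspaceZ => //; apply: subspaceD => //.
  exact: simple_sub_socle simN _ Nab.
apply: (simple_sub_socle simN'); exists a, b.
by rewrite scale1r scaleN1r.
Qed.

End Diagonal.

(** By irreducibility V^1 S either meets [S] in zero or contains it. *)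
Lemma simple_sub_socle_over_A0 S : simple_submod A0 S -> S `<=` socle M.
Proof.
move=> simS; have [sS _ _] := simS.
have [ST0|] := simple_submod_meet simS (act_span_submod sS).
  by apply: socle_of_disjoint_twist => //; rewrite setIC.
exact: socle_of_self_twisted.
Qed.

End Twist.

(** * From a sum of irreducible submodules to a direct sum *)

Section DirectSum.
Variables (R : realType) (U : vertex_superalgebra R) (M : weak_module U).
Implicit Types (S : set M) (F : set {classic (set M)}).

(** The family is indexed by its own members; [{classic _}] gives subsets of [M] the decidable
    equality needed for duplicate-free lists. *)
Definition independent F : Prop :=
  forall (s : seq {classic (set M)}) (f : {classic (set M)} -> M), uniq s ->
    (forall S, S \in s -> F S) -> (forall S, S \in s -> (S : set M) (f S)) ->
    \sum_(S <- s) f S = 0 -> forall S, S \in s -> f S = 0.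

Definition sum_of F : set M := lin_span [set x | exists2 S : set M, F S & S x].

Lemma sum_of_submod F : (forall S, F S -> submod setT S) -> submod setT (sum_of F).
Proof.
move=> FS; split; first exact: lin_span_subspace.
  apply: graded_span => x [S FS' Sx].
  have [_ /(_ _ Sx) [x0 [x1 [S0 p0 S1 p1 ->]]] _] := FS _ FS'.
  by exists x0, x1; split=> //; apply: mem_lin_span; exists S.
move=> u n w _; apply: lin_span_linear_image; first exact: act_linr.
  exact: lin_span_subspace.
move=> x [S FS' Sx]; apply: mem_lin_span; exists S => //.
by have [_ _ aS] := FS _ FS'; apply: aS.
Qed.

Lemma sum_of_sum F (s : seq {classic (set M)}) (f : {classic (set M)} -> M) :
  (forall S, S \in s -> F S) -> (forall S, S \in s -> (S : set M) (f S)) ->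
  sum_of F (\sum_(S <- s) f S).
Proof.
move=> sF sf; apply: subspace_sum => [|S Ss _]; first exact: lin_span_subspace.
by apply: mem_lin_span; exists (S : set M); [exact: sF|exact: sf].
Qed.

(** A finite part of the union of a chain lies in one member; the empty list is set apart because
    the chain may be empty. *)
Lemma total_on_seq (I : eqType) (G : set (set I)) (s : seq I) :
  total_on G subset -> (forall i, i \in s -> (\bigcup_(X in G) X) i) ->
  s = [::] \/ exists2 X, G X & forall i, i \in s -> X i.
Proof.
move=> totG; elim: s => [|i s IHs] sG; first by left.
right; have [X GX Xi] := sG i (mem_head _ _).
have [|->|[Y GY sY]] := IHs; first by move=> j js; apply: sG; rewrite inE js orbT.
  by exists X => // j; rewrite inE => /eqP ->.
have [XY|YX] := totG X Y GX GY.
  by exists Y => // j; rewrite inE => /predU1P[->|/sY //]; apply: XY.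
by exists X => // j; rewrite inE => /predU1P[->|/sY /YX].
Qed.

Lemma independent_bigcup (G : set (set {classic (set M)})) :
  G `<=` independent -> total_on G subset -> independent (\bigcup_(X in G) X).
Proof.
move=> Gind totG s f us sG sf sum0.
have [->//|[X GX sX]] := total_on_seq totG sG.
exact: (Gind X GX).
Qed.

Lemma independentU1 F S : is_subspace S ->
  (forall T : set M, F T -> is_subspace T) ->
  independent F -> sum_of F `&` S = [set 0] ->
  independent (F `|` [set S]).
Proof.
move=> subS subF indF FS0 s f us sF sf sum0.
have sumF : is_subspace (sum_of F) by apply: lin_span_subspace.
have [Ss|nSs] := boolP ((S : {classic (set M)}) \in s); last first.
  move=> T; apply: indF => // {}T Ts; case: (sF T Ts) => // TS.
  by rewrite -TS Ts in nSs.
have us' : uniq (rem (S : {classic (set M)}) s) by apply: rem_uniq.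
have inr T : T \in rem (S : {classic (set M)}) s -> F T /\ (T : set M) (f T).
  rewrite mem_rem_uniq // inE => /andP[/eqP TS Ts].
  by split; [case: (sF T Ts)|apply: sf].
move: (sum0); rewrite (big_rem (S : {classic (set M)})) //=.
set r := \sum_(_ <- rem _ _) _ => Er.
have Fr : sum_of F r by apply: sum_of_sum => T /inr[].
(* The term at [S] is minus the sum of the others, so it lies in both [sum_of F] and [S]. *)
have fS0 : f S = 0.
  suff : (sum_of F `&` S) (f S) by rewrite FS0.
  split; last exact: sf.
  move/eqP: Er; rewrite addr_eq0 => /eqP ->.
  by rewrite -scaleN1r; apply: subspaceZ.
rewrite fS0 add0r in Er.
move=> T Ts; have [->//|TS] := eqVneq T S.
apply: (indF _ f us' _ _ Er) => [T' /inr[]//|T' /inr[]//|].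
by rewrite mem_rem_uniq // inE TS.
Qed.

(** Zorn's lemma gives a maximal independent family of irreducible submodules. An irreducible [S]
    outside its sum would meet the sum in zero and could be added. *)
Lemma ex_independent_simple : socle M = setT ->
  exists F, [/\ independent F, forall S, F S -> simple_submod setT S &
    sum_of F = setT].
Proof.
move=> socT.
have [|F [[indF simF] maxF]] := @Zorn_bigcup {classic (set M)}
    [set F | independent F /\ forall S : set M, F S -> simple_submod setT S].
  move=> G GP totG; split.
    by apply: independent_bigcup => // X /GP[].
  by move=> S [X /GP[_ simX] /simX].
have sumF : submod setT (sum_of F).
  by apply: sum_of_submod => S /simF[].
exists F; split=> //; apply/seteqP; split=> // x _.
have : socle M x by rewrite socT.
apply: lin_span_min x; first by case: sumF.
move=> x [S simS Sx]; have [sS S_neq0 _] := simS; have [subS _ _] := sS.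
have [FS0|] := simple_submod_meet simS sumF; last exact.
(* A member of [F] lies in the sum and would be zero; so adding [S] enlarges [F] strictly. *)
have FS : ~ F S.
  move=> FS; apply: S_neq0; rewrite -FS0; apply/seteqP; split=> [y Sy|y []//].
  by split=> //; apply: mem_lin_span; exists S.
case: (maxF (F `|` [set (S : {classic (set M)})])).
  by split=> [|/(_ S)]; [exact: subsetUl|move=> H; apply: FS; apply: H; right].
split; last by move=> T [/simF|->].
by apply: independentU1 => // T /simF[[]].
Qed.

Lemma lin_span_bigcup (I : choiceType) (N : I -> set M) (x : M) :
  (forall i, is_subspace (N i)) -> lin_span (\bigcup_i N i) x ->
  exists (s : seq I) (f : I -> M), (forall i, N i (f i)) /\ x = \sum_(i <- s) f i.
Proof.
move=> subN [n [c [e [Ne ->]]]].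
have /choice [k Nk] : forall j, exists i, N i (e j).
  by move=> j; have [i _ Ni] := Ne j; exists i.
(* The terms of the combination are grouped by the index [k j] chosen for each; [undup] makes every
   term count once. *)
exists (undup [seq k j | j <- enum 'I_n]), (fun i => \sum_(j < n | k j == i) c j *: e j).
split=> [i|].
  by apply: subspace_sum => // j _ /eqP <-; apply: subspaceZ.
under [RHS]eq_bigr do rewrite big_mkcond.
rewrite [RHS]exchange_big; apply: eq_bigr => j _ /=; rewrite -big_mkcond /=.
under [RHS]eq_bigl do rewrite eq_sym.
rewrite -big_filter (@filter_pred1_uniq _ _ (k j)) ?undup_uniq ?big_seq1 //.
by rewrite mem_undup; apply: map_f; rewrite mem_enum.
Qed.

Lemma socle_sum_of_irreducibles : socle M = setT -> sum_of_irreducibles M.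
Proof.
move=> /ex_independent_simple [F [indF simF sumF]].
pose I : choiceType := {S : {classic (set M)} | `[< F S >]}.
have sim (i : I) : simple_submod setT (val i : set M).
  by apply: simF; apply/asboolP; apply: valP i.
have sub (i : I) : submod setT (val i : set M) by case: (sim i).
exists I, (fun i => submodule_of (sub i)); split; last first.
  by move=> i; apply/irreducible_simple_submod; rewrite submodule_ofE.
have E (i : I) : sub_set (submodule_of (sub i)) = (val i : set M).
  exact: submodule_ofE.
split=> [i|w|s f us sf sum0 i is_].
- exact: sub_subspace.
- apply: (@lin_span_bigcup I (fun i => sub_set (submodule_of (sub i)))).
    by move=> i; apply: sub_subspace.
  have : sum_of F w by rewrite sumF.
  apply: lin_span_min w; first exact: lin_span_subspace.
  move=> w [S FS Sw]; apply: mem_lin_span.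
  by exists (exist _ (S : {classic (set M)}) (asboolT FS)) => //; rewrite E.
(* Independence of [F] speaks of functions on all subsets, so [f] is extended by zero outside
   [F]. *)
- pose g (S : {classic (set M)}) : M := if insub S is Some j then f j else 0.
  have gE j : g (val j) = f j by rewrite /g valK.
  rewrite -gE; apply: (indF (map val s) g).
  + by rewrite map_inj_uniq //; apply: val_inj.
  + by move=> _ /mapP[j _ ->]; apply/asboolP; apply: valP j.
  + by move=> _ /mapP[j _ ->]; rewrite gE -E.
  + by rewrite big_map; under eq_bigr do rewrite gE.
  + exact: map_f.
Qed.

End DirectSum.

(** * Restriction to V and semisimplicity over U *)

Lemma restrict_submod (R : realType) (V U : vertex_superalgebra R)
    (iota : subalgebra V U) (M : weak_module U) (S : set M) :
  submod (M := restrict_module iota M) setT S <-> submod (range iota) S.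
Proof.
split=> -[subS gS aS]; split=> //.
  by move=> _ n w [v _ <-]; apply: (aS v).
by move=> v n w _; apply: aS; exists v.
Qed.

Lemma restrict_simple_submod (R : realType) (V U : vertex_superalgebra R)
    (iota : subalgebra V U) (M : weak_module U) (S : set M) :
  simple_submod (M := restrict_module iota M) setT S ->
  simple_submod (range iota) S.
Proof.
move=> [/restrict_submod sS S_neq0 minS]; split=> // T /restrict_submod.
exact: minS.
Qed.

(** The preimage of [N] in V is a nonzero submodule of the adjoint module of V; by simplicity it is
    everything and contains the vacuum. *)
Lemma vac_of_submodule (R : realType) (V U : vertex_superalgebra R)
    (iota : subalgebra V U) (hV_even : purely_even V) (hV_simple : simple_vsa V)
    (N : submodule (restrict_module iota (adjoint_module U))) :
  sub_set N `<=` range iota -> (exists2 x, sub_set N x & x <> 0) ->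
  sub_set N vac.
Proof.
move=> N_iota [x Nx x_neq0]; have [_ minV] := hV_simple.
have [[N0 NL] _ aN] := submodule_submod N.
have sS : submod (M := adjoint_module V) setT [set v | sub_set N (iota v)].
  split.
  - split; first by rewrite /= (linear_fun0 (@incl_linear _ _ _ iota)).
    by move=> a v w Nv Nw; rewrite /= incl_linear; apply: NL.
  - move=> v Nv; exists v, 0; split.
    + by [].
    + by rewrite hV_even.
    + by rewrite /= (linear_fun0 (@incl_linear _ _ _ iota)).
    + by case: (par_subspace V true).
    + by rewrite addr0.
  - by move=> v n w _ Nw /=; rewrite incl_mode; apply: (aN v).
case: (minV (submodule_of sS)); rewrite submodule_ofE => SE.
  have [v _ Ev] := N_iota _ Nx; case: x_neq0.
  have : [set v | sub_set N (iota v)] v by rewrite /= Ev.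
  by rewrite SE => /= v0; rewrite -Ev v0 (linear_fun0 (@incl_linear _ _ _ iota)).
have : [set v | sub_set N (iota v)] vac by rewrite SE.
by rewrite /= incl_vac.
Qed.

Theorem theorem4p2 (R : realType) (U V : vertex_operator_superalgebra R)
    (hV_even : purely_even V) (hV_simple : simple_vsa V)
    (iota : subalgebra V U) (h_omega : iota omega = omega)
    (hU : exists V1 : submodule (restrict_module iota (adjoint_module U)),
      [/\ irreducible_module (submodule_module V1),
          ordinary_module (submodule_module V1),
          is_direct_sum (W := U) (fun b : bool =>
            if b then sub_set V1 else range iota)
        & exists V11 : submodule (restrict_module iota (adjoint_module U)),
            [/\ sub_set V11 = mode_span (sub_set V1) (sub_set V1),
                sub_set V11 `<=` range iota
              & isomorphic_modules (submodule_module V11) (adjoint_module V)]])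
    (C : weak_module V -> Prop)
    (hC_semisimple : semisimple_category C)
    (hC_sub : closed_under_submodules C)
    (D : weak_module U -> Prop)
    (hD : forall M : weak_module U, D M <-> C (restrict_module iota M)) :
  semisimple_category D.
Proof.
move=> M /hD /hC_semisimple [I [N [[_ genN _] irrN]]].
have [V1 [_ _ dirU [V11 [V11E V11_iota [f [fL [g gf fg] _ _]]]]]] := hU.
have [subV1 gV1 aV1] := submodule_submod V1.
apply: socle_sum_of_irreducibles; apply/seteqP; split=> // w _.
have [s [h [Nh ->]]] := genN w.
have subsoc : is_subspace (socle M) by apply: lin_span_subspace.
apply: subspace_sum => // i _ _.
have simN : simple_submod (M := M) (range iota) (sub_set (N i)).
  exact/restrict_simple_submod/irreducible_simple_submod.
(* It remains to verify the assumptions on the two summands, the image of V and [V1]. *)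
apply: (simple_sub_socle_over_A0 _ _ _ _ _ _ simN (Nh i)).
- move=> _ [v _ <-]; exists (iota v), 0; split.
  + by exists v.
  + by apply: incl_par; rewrite hV_even.
  + by exists 0 => //; rewrite (linear_fun0 (@incl_linear _ _ _ iota)).
  + by case: (par_subspace U true).
  + by rewrite addr0.
- exact: gV1.
- by move=> _ n w' [v _ <-]; apply: aV1.
- move=> u n v V1u V1v; apply: V11_iota; rewrite V11E.
  by apply: mem_lin_span; exists u, v, n.
- move=> u; have [dsub /(_ u) [t [k [tk ->]]] _] := dirU.
  exists (\sum_(b <- t | ~~ b) k b), (\sum_(b <- t | b) k b); split.
  + apply: subspace_sum; first exact: (dsub false).
    by move=> [] // _ _; apply: (tk false).
  + apply: subspace_sum; first exact: (dsub true).
    by move=> [] // _ _; apply: (tk true).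
  + by rewrite (bigID (fun b : bool => b)) addrC.
(* V^1 V^1 is nonzero: it contains the preimage [g v] of a nonzero [v] under the isomorphism with
   V. *)
- rewrite -V11E; apply: vac_of_submodule => //.
  have [[v v_neq0] _] := hV_simple.
  exists (sub_val (g v)); first exact: sub_in.
  move=> gv0; apply: v_neq0; rewrite -(fg v) -(linear_fun0 fL); congr f.
  exact: val_inj.
Qed.
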